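(* Let $\mathsf{X}=(X_1,X_2,\ldots)$ be a sequence of finite non-empty sets such that the sequence of cardinalities $(|X_i|)_{i\ge 1}$ is bounded. Then the group of all bounded automorphisms of the rooted tree $\mathsf{X}^*$ does not contain free non-abelian subgroups.
   Context: Given a sequence $\mathsf{X}=(X_1,X_2,\ldots)$ of finite sets, put $\mathsf{X}^0=\{\varnothing\}$, $\mathsf{X}^n=X_1\times\cdots\times X_n$ for $n\ge1$, and $\mathsf{X}^*=\bigcup_{n\ge0}\mathsf{X}^n$, regarded as a set of words; $|v|$ is the length of $v\in\mathsf{X}^*$. It is a rooted tree with root the empty word $\varnothing$, in which $v\in\mathsf{X}^n$ is connected to all $vx$ with $x\in X_{n+1}$. Its boundary is identified with the set of infinite sequences $\mathsf{X}^\omega=X_1\times X_2\times\cdots$. Put $\mathsf{X}_n=(X_{n+1},X_{n+2},\ldots)$, with the corresponding tree $\mathsf{X}_n^*$. Automorphisms of $\mathsf{X}^*$ are tree automorphisms fixing the root. For an automorphism $g$ of $\mathsf{X}^*$ and $v\in\mathsf{X}^*$, $g|_v$ is the unique automorphism of $\mathsf{X}_{|v|}^*$ such that $g(vu)=g(v)\,g|_v(u)$ for all $u\in\mathsf{X}_{|v|}^*$. An automorphism $g$ of such a tree $\mathsf{X}^*$ is finitary if there exists $n$ such that $g|_v$ is trivial for all $v\in\mathsf{X}^n$; the smallest such $n$ is the depth of $g$. (The same definition is applied to automorphisms of the trees $\mathsf{X}_k^*$.) An automorphism $g$ of $\mathsf{X}^*$ is bounded if there exist a finite set of sequences $W\subset\mathsf{X}^\omega$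 and a number $n$ such that whenever $v\in\mathsf{X}^*$ is not a beginning (prefix) of any element of $W$, the automorphism $g|_v$ is finitary of depth at most $n$. The bounded automorphisms of $\mathsf{X}^*$ form a group. *)

(* Defs.v *)
From HB Require Import structures.
From mathcomp Require Import all_boot all_classical.

Set Implicit Arguments.
Unset Strict Implicit.
Unset Printing Implicit Defensive.

Local Open Scope group_scope.
Local Open Scope classical_set_scope.

(* The alphabets are indexed from 0: [X i] is the alphabet X_{i+1} of the usual
   1-based notation.  A letter carries the index of its alphabet, and the
   vertices of the tree X_k^* are the words whose letters have the successive
   indices k, k+1, k+2, ...  In this way concatenating v in X_k^* with u in
   X_(k+|v|)^* is concatenation of sequences, without any cast. *)

Section Trees.
Variable X : nat -> finType.

Definition letter : Type := {i : nat & X i}.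

Definition is_word (k : nat) (s : seq letter) : bool :=
  map tag s == iota k (size s).

Definition vertex (k : nat) : Type := {s : seq letter | is_word k s}.

Definition len k (v : vertex k) : nat := size (val v).

Lemma root_subproof k : is_word k [::]. Proof. by []. Qed.
Definition root k : vertex k := exist _ [::] (root_subproof k).

Lemma is_word_cat k (s t : seq letter) :
  is_word k (s ++ t) = is_word k s && is_word (k + size s) t.
Proof.
by rewrite /is_word map_cat size_cat iotaD eqseq_cat // size_map size_iota.
Qed.

(* The concatenation vu.  The length n of v is a parameter, because u has to
   live in the same tree X_(k+n)^* when it is appended to v and to g(v). *)
Definition wcat k n (v : vertex k) (vn : len v = n) (u : vertex (k + n)) :
    vertex k :=
  exist _ (val v ++ val u)
    (etrans (is_word_cat _ _ _)
       (introT andP (conj (valP v) (eq_ind_r (fun m => is_word (k + m) (val u))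
                                      (valP u) vn)))).

Lemma letterP (n : nat) (a : letter) :
  tag a = n -> exists x : X n, a = Tagged X x.
Proof. by case: a => i x /= <-; exists x. Qed.

Definition child k (u v : vertex k) : Prop :=
  exists x : X (k + len u), val v = rcons (val u) (Tagged X x).

Definition adjacent k (u v : vertex k) : Prop := child u v \/ child v u.

(* Automorphisms of the rooted tree X_k^*: automorphisms of the underlying
   graph which fix the root.  Preservation of levels is not assumed, see
   [len_aut]. *)
Record aut (k : nat) : Type := Aut {
  aut_fun :> vertex k -> vertex k;
  aut_inv : vertex k -> vertex k;
  aut_funK : cancel aut_fun aut_inv;
  aut_invK : cancel aut_inv aut_fun;
  aut_root : aut_fun (root k) = root k;
  aut_adj : forall u v, adjacent (aut_fun u) (aut_fun v) <-> adjacent u v }.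

Lemma aut_eq k (g h : aut k) : aut_fun g =1 aut_fun h -> g = h.
Proof.
case: g h => [f fi fK fiK fr fa] [f' fi' fK' fiK' fr' fa'] /= /funext E.
subst f'; have E : fi = fi' by apply/funext => x; rewrite -{1}(fiK' x) fK.
subst fi'; congr Aut; exact: Prop_irrelevance.
Qed.

Section Group.
Variable k : nat.
Implicit Types g h : aut k.

Definition aut1 : aut k :=
  @Aut k id id (fun=> erefl) (fun=> erefl) erefl (fun _ _ => iff_refl _).

Lemma aut_mul_root g h : g (h (root k)) = root k.
Proof. by rewrite !aut_root. Qed.

Lemma aut_mul_adj g h u v : adjacent (g (h u)) (g (h v)) <-> adjacent u v.
Proof. by split => [/aut_adj/aut_adj | ?]; last do 2!apply/aut_adj. Qed.

Definition aut_mul g h : aut k :=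
  @Aut k (g \o h) (aut_inv h \o aut_inv g)
    (can_comp (@aut_funK k g) (@aut_funK k h))
    (can_comp (@aut_invK k h) (@aut_invK k g))
    (aut_mul_root g h) (aut_mul_adj g h).

Lemma aut_inv_root g : aut_inv g (root k) = root k.
Proof. by rewrite -{1}(aut_root g) aut_funK. Qed.

Lemma aut_inv_adj g u v : adjacent (aut_inv g u) (aut_inv g v) <-> adjacent u v.
Proof.
by rewrite -{2}(aut_invK g u) -{2}(aut_invK g v); apply: iff_sym; apply: aut_adj.
Qed.

Definition aut_V g : aut k :=
  @Aut k (aut_inv g) g (@aut_invK k g) (@aut_funK k g)
    (aut_inv_root g) (aut_inv_adj g).

HB.instance Definition _ := gen_eqMixin (aut k).
HB.instance Definition _ := gen_choiceMixin (aut k).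

Lemma aut_mulA : associative aut_mul. Proof. by move=> g h f; apply: aut_eq. Qed.
Lemma aut_mul1 : left_id aut1 aut_mul. Proof. by move=> g; apply: aut_eq. Qed.
Lemma aut_mulr1 : right_id aut1 aut_mul. Proof. by move=> g; apply: aut_eq. Qed.
Lemma aut_mulV : left_inverse aut1 aut_V aut_mul.
Proof. by move=> g; apply: aut_eq => v; apply: aut_funK. Qed.
Lemma aut_mulrV : right_inverse aut1 aut_V aut_mul.
Proof. by move=> g; apply: aut_eq => v; apply: aut_invK. Qed.

HB.instance Definition _ := isGroup.Build (aut k)
  aut_mulA aut_mul1 aut_mulr1 aut_mulV aut_mulrV.

End Group.

Lemma child_len k (u v : vertex k) : child u v -> len v = (len u).+1.
Proof. by case=> x; rewrite /len => ->; rewrite size_rcons. Qed.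

Lemma has_parent k n (v : vertex k) :
  len v = n.+1 -> exists2 u, child u v & len u = n.
Proof.
case: v => s ws; rewrite /len /=.
case/lastP: s ws => [//|s a] ws; rewrite size_rcons => -[sn].
have := ws; rewrite -{1}cats1 is_word_cat => /andP[ws' /eqP /= [ka]].
have [x xa] := letterP ka.
by exists (exist _ s ws') => //; exists x; rewrite -xa.
Qed.

Lemma len_aut k (g : aut k) (v : vertex k) : len (g v) = len v.
Proof.
have [n] := ubnP (len v); elim: n => // n IHn in g v *; rewrite ltnS => lvn.
case E: (len v) => [|m].
  suff -> : v = root k by rewrite aut_root.
  by apply: val_inj; apply: size0nil.
have [u uv um] := has_parent E.
have gum : len (g u) = m by rewrite IHn // um -E.
have : adjacent (g u) (g v) by apply/aut_adj; left.
case=> /child_len; rewrite gum // => mE.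
have lt : len (g v) < n by rewrite (leq_trans _ lvn) // E mE.
have := IHn g^-1 (g v) lt; rewrite [_ (g v)]aut_funK E mE => /eqP.
by rewrite -addn2 -[X in _ == X]addn0 eqn_add2l.
Qed.

Lemma child_aut k (g : aut k) (u v : vertex k) : child u v -> child (g u) (g v).
Proof.
move=> uv; have : adjacent (g u) (g v) by apply/aut_adj; left.
case=> // /child_len; rewrite !len_aut (child_len uv) => /eqP.
by rewrite -addn2 -[X in X == _]addn0 eqn_add2l.
Qed.

Lemma child_autE k (g : aut k) (u v : vertex k) :
  child (g u) (g v) <-> child u v.
Proof.
split=> [/(child_aut g^-1)|]; last exact: child_aut.
by rewrite ![g^-1 (g _)]aut_funK.
Qed.

Section Wcat.
Variables (k n : nat) (v : vertex k) (vn : len v = n).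

Lemma wcat_inj : injective (wcat vn).
Proof.
by move=> u w /(congr1 val) /= /eqP; rewrite eqseq_cat // eqxx => /eqP/val_inj.
Qed.

Lemma wcat_child u w : child (wcat vn u) (wcat vn w) <-> child u w.
Proof.
have e : k + n + len u = k + len (wcat vn u).
  by rewrite {2}/len /= size_cat [size (val v)]vn addnA.
split=> -[x /= ux].
- have [y xy] := letterP (a := Tagged X x) (esym e).
  exists y; move: ux => /eqP; rewrite rcons_cat eqseq_cat // eqxx => /eqP.
  by rewrite -xy.
- have [y xy] := letterP (a := Tagged X x) e.
  by exists y; rewrite /= ux xy rcons_cat.
Qed.

Lemma wcatP (w : vertex k) :
  prefix (val v) (val w) -> exists u, w = wcat vn u.
Proof.
case/prefixP=> t wE; have := valP w.
rewrite wE is_word_cat => /andP[_]; rewrite [size _]vn => wt.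
by exists (exist _ t wt); apply: val_inj.
Qed.

Lemma wcat_root : wcat vn (root _) = v.
Proof. by apply: val_inj; rewrite /= cats0. Qed.

End Wcat.

Section Sections.
Variables (k : nat) (g : aut k) (v : vertex k).

Let gcat : vertex (k + len v) -> vertex k := wcat (len_aut g v).
Let vcat : vertex (k + len v) -> vertex k := wcat (erefl (len v)).

Lemma section_subproof u : exists w, g (vcat u) = gcat w.
Proof.
apply: wcatP; have [n] := ubnP (len u); elim: n => // n IHn in u *.
rewrite ltnS => lun; case E: (len u) => [|m].
  suff -> : u = root _ by rewrite [vcat _]wcat_root prefix_refl.
  by apply: val_inj; apply: size0nil.
have [w wu wm] := has_parent E.
have /(child_aut g) [x ->] : child (vcat w) (vcat u) by apply/wcat_child.
rewrite -cats1; apply: prefix_trans (prefix_prefix _ _).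
by apply: IHn; rewrite wm -E.
Qed.

Lemma section_inv_subproof w : exists u, g (vcat u) = gcat w.
Proof.
suff [u uE] : exists u, g^-1 (gcat w) = vcat u.
  by exists u; rewrite -uE [g _]aut_invK.
apply: wcatP; have [n] := ubnP (len w); elim: n => // n IHn in w *.
rewrite ltnS => lwn; case E: (len w) => [|m].
  suff -> : w = root _.
    by rewrite [gcat _]wcat_root [g^-1 (g _)]aut_funK prefix_refl.
  by apply: val_inj; apply: size0nil.
have [u uw um] := has_parent E.
have /(child_aut g^-1) [x ->] : child (gcat u) (gcat w) by apply/wcat_child.
rewrite -cats1; apply: prefix_trans (prefix_prefix _ _).
by apply: IHn; rewrite um -E.
Qed.

Definition section_fun u := projT1 (cid (section_subproof u)).
Definition section_inv w := projT1 (cid (section_inv_subproof w)).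

Lemma section_funE u : g (vcat u) = gcat (section_fun u).
Proof. exact: projT2 (cid (section_subproof u)). Qed.

Lemma section_invE w : g (vcat (section_inv w)) = gcat w.
Proof. exact: projT2 (cid (section_inv_subproof w)). Qed.

Lemma section_funK : cancel section_fun section_inv.
Proof.
move=> u; apply: (@wcat_inj _ _ v (erefl _)); apply: (can_inj (@aut_funK k g)).
by rewrite section_invE section_funE.
Qed.

Lemma section_invK : cancel section_inv section_fun.
Proof.
by move=> w; apply: (@wcat_inj _ _ _ (len_aut g v));
  rewrite -/gcat -section_funE section_invE.
Qed.

Lemma section_root : section_fun (root _) = root _.
Proof.
apply: (@wcat_inj _ _ _ (len_aut g v)); rewrite -/gcat -section_funE.
by rewrite [vcat _]wcat_root [gcat _]wcat_root.
Qed.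

Lemma section_adj u w :
  adjacent (section_fun u) (section_fun w) <-> adjacent u w.
Proof.
have E a b : child (section_fun a) (section_fun b) <-> child a b.
  rewrite -(wcat_child (len_aut g v)) -/gcat -!section_funE child_autE.
  by rewrite [child (vcat _) _]wcat_child.
by rewrite /adjacent !E.
Qed.

(* The section g|_v; it is characterized by [sectionE] and [section_uniq]. *)
Definition section : aut (k + len v) :=
  Aut section_funK section_invK section_root section_adj.

Lemma sectionE u : g (wcat (erefl (len v)) u) = wcat (len_aut g v) (section u).
Proof. exact: section_funE. Qed.

Lemma section_uniq (h : aut (k + len v)) :
  (forall u, g (wcat (erefl (len v)) u) = wcat (len_aut g v) (h u)) ->
  h = section.
Proof.
by move=> hE; apply: aut_eq => u; apply: (@wcat_inj _ _ _ (len_aut g v));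
  rewrite -hE sectionE.
Qed.

End Sections.

Definition trivial_at_level k (g : aut k) (n : nat) : Prop :=
  forall v : vertex k, len v = n -> section g v = 1.

Definition is_depth k (g : aut k) (d : nat) : Prop :=
  trivial_at_level g d /\ forall n, trivial_at_level g n -> d <= n.

Definition finitary_of_depth_at_most k (g : aut k) (n : nat) : Prop :=
  exists2 d, is_depth g d & d <= n.

Definition beginning (v : vertex 0) (w : forall i, X i) : Prop :=
  val v = mkseq (fun i => Tagged X (w i)) (len v).

Definition bounded (g : aut 0) : Prop :=
  exists (W : set (forall i, X i)) (n : nat), finite_set W /\
    forall v : vertex 0, (forall w, W w -> ~ beginning v w) ->
      finitary_of_depth_at_most (section g v) n.

Definition bounded_automorphisms : set (aut 0) := [set g | bounded g].

End Trees.

Arguments bounded_automorphisms : clear implicits.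

Section FreeGroups.
Variable G : groupType.

(* Group words over G: the pair (x, e) stands for x if e is [false], and for
   its inverse if e is [true]. *)
Definition eval_letter (a : G * bool) : G := if a.2 then a.1^-1 else a.1.

Definition eval_word (s : seq (G * bool)) : G := \prod_(a <- s) eval_letter a.

Definition reduced (s : seq (G * bool)) : bool :=
  sorted (fun a b => ~~ ((a.1 == b.1) && (a.2 != b.2))) s.

Definition words_over (S : set G) : set (seq (G * bool)) :=
  [set s | forall a, a \in s -> S a.1].

Definition freely_generates (S H : set G) : Prop :=
  H = [set eval_word s | s in words_over S] /\
  forall s, words_over S s -> reduced s -> eval_word s = 1 -> s = [::].

Definition subgroup (H : set G) : Prop := group_closed [in H].

Definition free_group (H : set G) : Prop := exists S, freely_generates S H.

Definition abelian_group (H : set G) : Prop :=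
  forall x y, H x -> H y -> commute x y.

End FreeGroups.

(* Main.v *)
Require Import Defs.
From HB Require Import structures.
From mathcomp Require Import all_boot all_classical zify.

Set Implicit Arguments.
Unset Strict Implicit.
Unset Printing Implicit Defensive.

Local Open Scope classical_set_scope.

(** A free non-abelian group of bounded automorphisms contains a free group F
    on two letters a and b, and the proof derives a contradiction by finding a
    ray of the tree on whose orbit F acts freely, and then comparing the growth
    of F with the growth of that orbit.

    The ray.  Call a vertex v rigid if only 1 in F fixes pointwise all the
    words that begin with v.  Every level n contains a rigid vertex
    ([exists_rigid]).  Otherwise each vertex v of level n would come with a
    nontrivial element of F that is trivial below v.  Suitable powers a^M and
    b^M of the generators fix level n, so conjugating by elements of
    <a^M, b^M> does not move the vertices of level n, and two nontrivial
    elements of F always have such conjugates that do not commute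
    ([free2_noncommuting_conj]).  A commutator is trivial wherever one of its
    two entries is, so iterating commutators over the vertices of level n
    yields a nontrivial element of F which acts trivially everywhere.  Since
    prefixes of rigid vertices are rigid, Koenig's lemma gives a ray x all of
    whose prefixes are rigid.

    Its stabilizer is trivial.  Call singular the finitely many rays along which
    a bounded g may have sections that are not finitary of bounded depth.  If g
    fixes x, then below some prefix of x at most x itself is singular.  A word that leaves x at level j is
    changed by g only in a window of bounded length starting at j; as alphabets
    have bounded size, one power of g, independent of j, fixes all these words
    ([bounded_fixing_ray]).  By rigidity this power is 1, and F is
    torsion-free, so g = 1.

    The count.  Identify reduced words w with the points w x of the orbit, and
    group them by the tail of w x after level k + m.  Passing from w to l w, for
    a letter l, changes this tail only if w x begins like one of the finitely
    many singular rays up to level k, and inside a class there are at most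
    N ^ m such points for each of these beginnings.  So boundedly many edges
    leave a class, with a bound that does not depend on k.  In the tree of
    reduced words every vertex has at least two children, so a class has at
    least as many edges leaving it as elements; hence the size of the classes
    is bounded uniformly in k ([tail_class_bound]).  On the other hand only
    finitely many points of the orbit are singular rays, so eventually
    consecutive powers a^i x and a^(i+1) x have a common tail, and arbitrarily
    many of them lie in one class: a contradiction. *)

(** * Free groups on two generators *)

Section FreeWords.
Local Open Scope group_scope.
Variable G : groupType.
Implicit Types (a b c d g h : G) (l x y : G * bool) (s t u w p q r : seq (G * bool)).

Definition inv_letter l := (l.1, ~~ l.2).
Definition inv_word s := rev (map inv_letter s).
Definition noncancel x y := ~~ ((x.1 == y.1) && (x.2 != y.2)).

Lemma noncancelE x y : noncancel x y = (inv_letter x != y).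
Proof.
by case: x y => [x e] [y f]; rewrite /noncancel /inv_letter /= xpair_eqE; case: e f => [] [].
Qed.

Lemma noncancel_inv x y : noncancel (inv_letter x) (inv_letter y) = noncancel y x.
Proof.
by case: x y => [x e] [y f]; rewrite /noncancel /= eq_sym; case: e f => [] [].
Qed.

Lemma reducedE s : reduced s = sorted noncancel s. Proof. by []. Qed.

Lemma reduced_cat s x y t :
  reduced (rcons s x ++ y :: t) = [&& reduced (rcons s x), noncancel x y & reduced (y :: t)].
Proof.
rewrite !reducedE; case: s => [|z s] /=; first by [].
by rewrite cat_path last_rcons.
Qed.

Lemma reduced_catl s t : reduced (s ++ t) -> reduced s.
Proof. by rewrite !reducedE; case: s => //= x s; rewrite cat_path => /andP[]. Qed.

Lemma reduced_catr s t : reduced (s ++ t) -> reduced t.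
Proof.
rewrite !reducedE; elim: s => //= x s IHs st; apply: IHs.
exact: path_sorted st.
Qed.

Lemma reduced_inv_word s : reduced (inv_word s) = reduced s.
Proof.
rewrite !reducedE /inv_word rev_sorted sorted_map; case: s => //= x s.
by apply: eq_path => y z /=; apply: noncancel_inv.
Qed.

Lemma nseq_rcons k l : nseq k.+1 l = rcons (nseq k l) l.
Proof. by rewrite -addn1 nseqD cats1. Qed.

Lemma reduced_nseq k l : reduced (nseq k l).
Proof.
rewrite reducedE; case: k => //= k; elim: k => //= k ->.
by rewrite /noncancel !eqxx.
Qed.

Lemma reduced_cat_nseq s x k l :
  reduced (rcons s x ++ nseq k.+1 l) = reduced (rcons s x) && noncancel x l.
Proof. by rewrite reduced_cat (reduced_nseq k.+1 l) andbT. Qed.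

Lemma eval_cons x s : eval_word (x :: s) = eval_letter x * eval_word s.
Proof. by rewrite /eval_word big_cons. Qed.

Lemma eval_nil : eval_word [::] = 1 :> G.
Proof. by rewrite /eval_word big_nil. Qed.

Lemma eval_cat s t : eval_word (s ++ t) = eval_word s * eval_word t.
Proof. by rewrite /eval_word big_cat. Qed.

Lemma eval_inv_letter l : eval_letter (inv_letter l) = (eval_letter l)^-1.
Proof. by case: l => x [] //=; rewrite /eval_letter /= invgK. Qed.

Lemma eval_inv_word s : eval_word (inv_word s) = (eval_word s)^-1.
Proof.
elim: s => [|x s IHs]; first by rewrite /inv_word /= eval_nil invg1.
rewrite /inv_word /= rev_cons -cats1 eval_cat IHs !eval_cons eval_nil mulg1 invgM.
by rewrite eval_inv_letter.
Qed.

Lemma eval_nseq k l : eval_word (nseq k l) = eval_letter l ^+ k.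
Proof. by elim: k => [|k IHk] /=; rewrite ?eval_nil // eval_cons IHk expgS. Qed.

Definition word_on a b s := all (fun l => l.1 \in [:: a; b]) s.
Definition gen2 a b g := exists2 w, word_on a b w & g = eval_word w.
Definition free2 a b :=
  forall s, word_on a b s -> reduced s -> eval_word s = 1 -> s = [::].

Lemma word_on_cat a b s t : word_on a b (s ++ t) = word_on a b s && word_on a b t.
Proof. exact: all_cat. Qed.

Lemma word_on_inv a b s : word_on a b (inv_word s) = word_on a b s.
Proof. by rewrite /word_on /inv_word all_rev all_map. Qed.

Lemma gen2M a b g h : gen2 a b g -> gen2 a b h -> gen2 a b (g * h).
Proof.
move=> [s hs ->] [t ht ->]; exists (s ++ t); rewrite ?eval_cat //.
by rewrite word_on_cat hs.
Qed.

Lemma gen2V a b g : gen2 a b g -> gen2 a b g^-1.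
Proof. by move=> [s hs ->]; exists (inv_word s); rewrite ?eval_inv_word // word_on_inv. Qed.

Lemma gen21 a b : gen2 a b 1.
Proof. by exists [::]; rewrite ?eval_nil. Qed.

Lemma gen2X a b g n : gen2 a b g -> gen2 a b (g ^+ n).
Proof.
by move=> Fg; elim: n => [|n IHn]; [exact: gen21 | rewrite expgS; apply: gen2M].
Qed.

Lemma gen2l a b : gen2 a b a.
Proof.
exists [:: (a, false)]; first by rewrite /word_on /= inE eqxx.
by rewrite eval_cons eval_nil mulg1.
Qed.

Lemma gen2r a b : gen2 a b b.
Proof.
exists [:: (b, false)]; first by rewrite /word_on /= !inE eqxx orbT.
by rewrite eval_cons eval_nil mulg1.
Qed.

(** The reduced form is built from the right: a letter put in front of a
    reduced word either cancels with its first letter or keeps it reduced. *)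
Lemma reduced_form a b w : word_on a b w ->
  exists r, [/\ word_on a b r, reduced r & eval_word r = eval_word w].
Proof.
elim: w => [|l w IHw]; first by exists [::].
move=> /= /andP[hl /IHw [r [hr rr er]]].
case: r => [|x r] in hr rr er *.
  by exists [:: l]; rewrite /word_on /= hl !eval_cons er.
case: (boolP (noncancel l x)) => lx.
  exists (l :: x :: r); rewrite eval_cons er -eval_cons; split=> //.
    by rewrite /word_on /= hl.
  by rewrite reducedE /= lx.
exists r; split.
- by case/andP: hr.
- by apply: (@reduced_catr [:: x]).
- move: lx; rewrite noncancelE negbK => /eqP lx.
  by rewrite eval_cons -er eval_cons -lx eval_inv_letter mulgA mulgV mul1g.
Qed.

Section Free.
Variables (a b : G).
Hypothesis free_ab : free2 a b.

(** After removing the common first letters of r and s, the word r^-1 s is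
    reduced and evaluates to 1, so it is empty. *)
Lemma eval_word_inj r s : word_on a b r -> word_on a b s -> reduced r -> reduced s ->
  eval_word r = eval_word s -> r = s.
Proof.
elim: r s => [|x r IHr] [|y s] hr hs rr rs // E.
- by rewrite -(free_ab hs rs) // -E eval_nil.
- by rewrite (free_ab hr rr) // E eval_nil.
case: (eqVneq x y) => [xy|xy].
  subst y; congr cons; apply: IHr; first by case/andP: hr.
  - by case/andP: hs.
  - exact: (@reduced_catr [:: x]).
  - exact: (@reduced_catr [:: x]).
  - by move: E; rewrite !eval_cons => /mulgI.
suff: inv_word (x :: r) ++ y :: s = [::] by case: (inv_word _).
apply: free_ab.
- by rewrite word_on_cat word_on_inv hr.
- have iE : inv_word (x :: r) = rcons (inv_word r) (inv_letter x).
    by rewrite /inv_word /= rev_cons.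
  rewrite iE reduced_cat -iE reduced_inv_word rr rs noncancelE andbT /=.
  by case: x xy {iE hr E rr} => z e xy; rewrite /inv_letter /= negbK.
- by rewrite eval_cat eval_inv_word E mulVg.
Qed.

(** Induction on the reduced word of g.  If its last and first letters do not
    cancel, its powers are reduced words; otherwise conjugating g by the first
    letter shortens the word. *)
Lemma free2_torsion_free g k : gen2 a b g -> g ^+ k.+1 = 1 -> g = 1.
Proof.
move=> [w0 hw0 ->]; have [w [hw rw <-]] := reduced_form hw0; clear w0 hw0.
have [n] := ubnP (size w); elim: n => // n IHn in w hw rw *; rewrite ltnS => wn E.
case: w => [|x w] in hw rw wn E *; first by rewrite eval_nil.
case/lastP: w => [|w y] in hw rw wn E *.
  have /free_ab : eval_word (nseq k.+1 x) = 1 by rewrite eval_nseq -E eval_cons eval_nil mulg1.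
  rewrite reduced_nseq /word_on all_nseq /= => F.
  by case/andP: hw => /F{}F _; have := F isT.
case: (boolP (noncancel y x)) => yx.
  pose v j := iter j (cat (x :: rcons w y)) [::].
  have vS j : v j.+1 = (x :: rcons w y) ++ v j by [].
  have ev j : eval_word (v j) = eval_word (x :: rcons w y) ^+ j.
    by elim: j => [|j IHj]; rewrite ?eval_nil // vS eval_cat IHj expgS.
  have hv j : word_on a b (v j) by elim: j => // j IHj; rewrite vS word_on_cat hw.
  have rv j : reduced (v j).
    elim: j => // -[|j] IHj; rewrite vS; first by rewrite cats0.
    have -> : v j.+1 = x :: (rcons w y ++ v j) by [].
    by rewrite -rcons_cons reduced_cat yx rcons_cons rw; apply: IHj.
  by have := free_ab (hv k.+1) (rv k.+1); rewrite ev E => /(_ erefl).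
have yE : y = inv_letter x.
  move: yx; rewrite noncancelE negbK => /eqP <-.
  by case: (y) => z e; rewrite /inv_letter /= negbK.
have cE : eval_word (x :: rcons w y) = eval_word w ^ (eval_letter x)^-1.
  by rewrite eval_cons -cats1 eval_cat eval_cons eval_nil mulg1 yE eval_inv_letter
             conjgE invgK mulgA.
rewrite cE (_ : eval_word w = 1) ?conj1g //; apply: IHn.
- by move: hw; rewrite -rcons_cons -cats1 word_on_cat => /andP[] /= /andP[].
- by apply: (@reduced_catl w [:: y]); rewrite cats1; apply: (@reduced_catr [:: x]).
- by move: wn; rewrite /= size_rcons; lia.
- by apply/eqP; rewrite -(conjg_eq1 _ (eval_letter x)^-1) conjXg -cE E.
Qed.

End Free.

(** A power of c which is longer than p dominates p, whatever the signs of the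
    letters of p are. *)
Lemma pow_absorb c p m : all (fun l => l.1 == c) p -> size p < m ->
  exists k, c ^+ m * eval_word p = c ^+ k.+1.
Proof.
elim: p m => [|[x e] p IHp] [|m] //.
  by exists m; rewrite eval_nil mulg1.
move=> /andP[/eqP/= -> hp]; rewrite /= ltnS => pm.
rewrite eval_cons mulgA; case: e; rewrite /eval_letter /=.
  by rewrite expgSr mulgK; apply: IHp.
by rewrite -expgSr; apply: IHp => //; lia.
Qed.

Lemma first_split (P : pred (G * bool)) w : has P w ->
  exists p y u, [/\ w = p ++ y :: u, all (predC P) p & P y].
Proof.
elim: w => //= x w IHw; case: (boolP (P x)) => [Px _|nPx /= /IHw [p [y [u [-> hp Py]]]]].
  by exists [::], x, w.
by exists (x :: p), y, u; rewrite /= nPx.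
Qed.

Lemma last_split (P : pred (G * bool)) w : has P w ->
  exists p y u, [/\ w = rcons p y ++ u, all (predC P) u & P y].
Proof.
rewrite -has_rev => /first_split [p [y [u [E hp Py]]]].
exists (rev u), y, (rev p); split=> //; last by rewrite all_rev.
by rewrite -[w]revK E rev_cat rev_cons.
Qed.

(** Words c ... c^-1.  Two such words for distinct letters c and d can be
    multiplied, in any order and also after inversion, without cancellation. *)
Definition bracketed c w := exists u, w = (c, false) :: rcons u (c, true).

(** Write w = p t q, where t begins and ends with a letter other than c^(+-1),
    and p and q are powers of c.  Conjugation by a large power of c turns p into
    a positive and q into a negative power of c, and leaves t in place. *)
Lemma conj_pow_bracketed a b c w m : c \in [:: a; b] ->
  word_on a b w -> reduced w -> has (fun l => l.1 != c) w -> size w < m ->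
  exists v, [/\ word_on a b v, reduced v, bracketed c v &
                eval_word v = c ^+ m * eval_word w / c ^+ m].
Proof.
move=> hc hw rw /first_split [p [y [u [wE hp yc]]]] wm.
have [|p' [z [q [uE hq zc]]]] := @last_split (fun l => l.1 != c) (y :: u).
  by rewrite /= yc.
have {}hp : all (fun l => l.1 == c) p.
  by apply: sub_all hp => l /=; rewrite negbK.
have {}hq : all (fun l => l.1 == c) (inv_word q).
  by rewrite /inv_word all_rev all_map; apply: sub_all hq => l /=; rewrite negbK.
move: wm; rewrite wE uE !size_cat => wm.
have [|k kE] := pow_absorb (m := m) hp; first by lia.
have [|k' kE'] := pow_absorb (m := m) hq.
  by rewrite /inv_word size_rev size_map; lia.
exists (nseq k.+1 (c, false) ++ rcons p' z ++ nseq k'.+1 (c, true)); split.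
- rewrite !word_on_cat /word_on !all_nseq /= hc ?orbT /= andbT.
  by move: hw; rewrite wE uE !word_on_cat => /andP[_ /andP[]].
- have r1 : reduced (rcons p' z ++ nseq k'.+1 (c, true)).
    rewrite reduced_cat_nseq /noncancel (negbTE zc) andbT.
    by apply: (@reduced_catl _ q); rewrite -uE; apply: (@reduced_catr p); rewrite -wE.
  have [t tE] : exists t, rcons p' z = y :: t.
    by case: (p') uE => [|y' t] [-> _]; [exists [::] | exists (rcons t z)].
  move: r1; rewrite tE (nseq_rcons k) cat_cons reduced_cat -nseq_rcons reduced_nseq => ->.
  by rewrite /noncancel eq_sym (negbTE yc).
- by exists (nseq k (c, false) ++ rcons p' z ++ nseq k' (c, true)); rewrite !rcons_cat -nseq_rcons.
- rewrite !eval_cat (mulgA (c ^+ m)) kE !eval_nseq -!mulgA; congr (_ * (_ * _)); apply: invg_inj.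
  by rewrite invgM invgK -eval_inv_word kE' /eval_letter /= expVgn invgK.
Qed.

(** The only case left open by [conj_pow_bracketed] is that of a power of c; it
    is conjugated first by d^M, which brings in letters d. *)
Lemma conj_bracketed a b c d g M : free2 a b -> c \in [:: a; b] -> d \in [:: a; b] ->
  c != d -> gen2 a b g -> g != 1 -> 0 < M ->
  exists i j v, [/\ word_on a b v, reduced v, bracketed c v &
    eval_word v = (c ^+ (M * i) * d ^+ (M * j)) * g / (c ^+ (M * i) * d ^+ (M * j))].
Proof.
move=> free_ab hc hd cd [w0 hw0 ->] g1 M0.
have [w [hw rw wE]] := reduced_form hw0; rewrite -wE in g1 *; clear w0 hw0 wE.
case: (boolP (has (fun l => l.1 != c) w)) => wc.
  have [v [hv rv bv vE]] := conj_pow_bracketed (m := M * (size w).+1) hc hw rw wc ltac:(nia).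
  by exists (size w).+1, 0, v; rewrite muln0 expg0 mulg1.
pose w' := nseq M (d, false) ++ w ++ nseq M (d, true).
have hw' : word_on a b w'.
  by rewrite !word_on_cat hw /word_on !all_nseq /= hd ?orbT.
have w'c : has (fun l => l.1 != c) w' by rewrite has_cat has_nseq M0 /= eq_sym cd.
have rw' : reduced w'.
  move: wc; rewrite -all_predC => wc; rewrite /w'.
  case: w => [|x w] in hw rw g1 wc w' hw' w'c *; first by rewrite eval_nil eqxx in g1.
  rewrite -(prednK M0) nseq_rcons cat_cons reduced_cat -nseq_rcons reduced_nseq.
  have xc : x.1 = c by apply/eqP; case/andP: wc; rewrite /= negbK.
  have -> : noncancel (d, false) x by rewrite /noncancel xc eq_sym (negbTE cd).
  rewrite !andTb -cat_cons.
  have xw0 : x :: w != [::] by [].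
  case/lastP: (x :: w) xw0 rw wc => // s y _ rs; rewrite /= all_rcons /= negbK => /andP[/eqP yc _].
  by rewrite reduced_cat_nseq rs /noncancel yc (negbTE cd).
have [v [hv rv bv vE]] := conj_pow_bracketed (m := M * (size w').+1) hc hw' rw' w'c ltac:(nia).
exists (size w').+1, 1%N, v; split=> //.
rewrite vE /w' !eval_cat !eval_nseq /eval_letter /= muln1 expVgn invgM !mulgA.
by [].
Qed.

Lemma bracketed_inv c w : bracketed c w -> bracketed c (inv_word w).
Proof.
move=> [u ->]; exists (inv_word u).
by rewrite /inv_word /= map_rcons rev_cons rev_rcons.
Qed.

Lemma reduced_bracketed_cat c d v w s : c != d -> bracketed c v -> bracketed d w ->
  reduced v -> reduced (w ++ s) -> reduced (v ++ w ++ s).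
Proof.
move=> cd [u ->] [t ->] rv rw; rewrite -rcons_cons reduced_cat rv.
by rewrite {1}/noncancel (negbTE cd) rw.
Qed.

(** The conjugates are chosen to be given by words a ... a^-1 and b ... b^-1, so
    that their commutator is reduced as it is written.  The exponents are
    multiples of M so that the conjugating elements lie in a given subgroup of
    finite index. *)
Lemma free2_noncommuting_conj a b g h M : free2 a b -> a != b -> gen2 a b g -> gen2 a b h ->
  g != 1 -> h != 1 -> 0 < M ->
  exists f f', [/\ exists i j, f = a ^+ (M * i) * b ^+ (M * j),
                exists i j, f' = b ^+ (M * i) * a ^+ (M * j) &
                (f * g / f) * (f' * h / f') / (f * g / f) / (f' * h / f') != 1].
Proof.
move=> free_ab ab Fg Fh g1 h1 M0.
have ha : a \in [:: a; b] by rewrite inE eqxx.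
have hb : b \in [:: a; b] by rewrite !inE eqxx orbT.
have [i [j [v [hv rv [u vE] ev]]]] := conj_bracketed free_ab ha hb ab Fg g1 M0.
rewrite eq_sym in ab.
have [i' [j' [w [hw rw [t wE] ew]]]] := conj_bracketed free_ab hb ha ab Fh h1 M0.
have bv : bracketed a v by exists u.
have bw : bracketed b w by exists t.
exists (a ^+ (M * i) * b ^+ (M * j)), (b ^+ (M * i') * a ^+ (M * j')).
split; [by exists i, j | by exists i', j' | rewrite -ev -ew {ev ew}].
rewrite -!eval_inv_word -!eval_cat; apply/eqP => E.
have ba : a != b by rewrite eq_sym.
suff rd : reduced (((v ++ w) ++ inv_word v) ++ inv_word w).
  have := free_ab _ _ rd E; rewrite !word_on_cat !word_on_inv hv hw => /(_ isT).
  by rewrite vE.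
have bv' := bracketed_inv bv; have bw' := bracketed_inv bw.
rewrite -!catA; apply: (reduced_bracketed_cat ba bv bw rv).
apply: (reduced_bracketed_cat ab bw bv' rw); rewrite -[inv_word w]cats0.
apply: (reduced_bracketed_cat ba bv' bw'); first by rewrite reduced_inv_word.
by rewrite cats0 reduced_inv_word.
Qed.

End FreeWords.

Section Letters.
Variables (G : groupType) (a b : G).
Hypothesis ab : a != b.
Definition letters := [:: (a, false); (a, true); (b, false); (b, true)].

Lemma mem_letters l : (l \in letters) = (l.1 \in [:: a; b]).
Proof. by case: l => y []; rewrite !inE !xpair_eqE /= !(andbT, andbF, orbF, orFb). Qed.

Lemma uniq_letters : uniq letters.
Proof. by rewrite /= !inE !xpair_eqE /= !(andbT, andbF, orbF, orFb) ab. Qed.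

(** A letter fails to extend w only if it is the inverse of the first letter of
    w, so there are in fact at least three extensions; two suffice here. *)
Lemma two_children w : word_on a b w -> reduced w ->
  2 <= count (fun l => reduced (l :: w)) letters.
Proof.
case: w => [//|z w] /andP[hz _] rw.
have nE l : reduced (l :: z :: w) = noncancel l z by move: rw; rewrite !reducedE /= => ->; rewrite andbT.
have ba : (b == a) = false by rewrite eq_sym (negbTE ab).
rewrite (eq_count nE); move: hz; rewrite !inE /noncancel /=.
by case: z {rw nE} => y e /= /orP[] /eqP ->; rewrite !eqxx ?ba ?(negbTE ab); case: e.
Qed.
End Letters.

(** If the free generating set had at most one element, all words in it would
    commute. *)
Lemma free_nonabelian_free2 (G : groupType) (H : set G) :
  free_group H -> ~ abelian_group H ->
  exists a b, [/\ a != b, free2 a b & forall g, gen2 a b g -> H g].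
Proof.
move=> [S [HE Sfree]] nab.
have [a [b [Sa Sb ab]]] : exists a b, [/\ S a, S b & a != b].
  apply: contrapT => nS; apply: nab => g h; rewrite HE => -[s hs <-] [t ht <-].
  have comm x y : S x.1 -> S y.1 -> commute (eval_letter x) (eval_letter y).
    case: x y => [x e] [y f] /= Sx Sy.
    have <- : x = y by apply: contrapT => /eqP xy; apply: nS; exists x, y.
    by case: e f => [] [] //; rewrite /eval_letter /=; [apply: commute_sym|]; apply: commuteV.
  rewrite /eval_word; elim: s hs => [|x s IHs] hs; rewrite ?big_nil.
    exact/commute_sym/commute1.
  rewrite big_cons; apply/commute_sym/commuteM; last first.
    by apply/commute_sym/IHs => y ys; apply: hs; rewrite inE ys orbT.
  apply/commute_sym; elim: t ht {IHs} => [|y t IHt] ht; rewrite ?big_nil; first exact: commute1.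
  rewrite big_cons; apply: commuteM.
    by apply: comm; [apply: hs | apply: ht]; apply: mem_head.
  by apply: IHt => z zt; apply: ht; rewrite inE zt orbT.
have Sab w : word_on a b w -> words_over S w.
  by move=> /allP hw l /hw; rewrite !inE => /orP[] /eqP ->.
exists a, b; split=> //; first by move=> w /Sab; apply: Sfree.
by move=> g [w /Sab hw ->]; rewrite HE; exists w.
Qed.

(** * Two finiteness principles *)

(** By the pigeonhole principle x returns to itself after at most Q steps, and
    the number of steps divides Q!.  The point of Q! is that it does not depend
    on x. *)
Lemma iter_fact_periodic (T : eqType) (f : T -> T) x (r : seq T) Q :
  injective f -> (forall i, iter i f x \in r) -> size r <= Q -> iter Q`! f x = x.
Proof.
move=> finj fr rQ.
have : ~~ uniq [seq iter i f x | i <- iota 0 Q.+1].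
  apply/negP => /(@uniq_leq_size _ _ r); rewrite size_map size_iota => H.
  suff : Q < size r by rewrite ltnNge rQ.
  by apply: H => _ /mapP [i _ ->].
move=> /(uniqPn x) [i [j [ij]]]; rewrite size_map size_iota ltnS => jQ.
rewrite !(nth_map 0) ?size_iota ?nth_iota ?add0n; try lia.
rewrite -(subnKC (ltnW ij)) iterD.
set y := iter (j - i) f x => E0.
have E : x = y by elim: (i) E0 => //= i' IHi' /finj.
have /dvdnP [q ->] : j - i %| Q`! by apply: dvdn_fact; lia.
by rewrite iterM; elim: q => //= q ->; rewrite -/y -E.
Qed.

(** A longest duplicate-free list of elements of A contains all of them. *)
Lemma finite_enumeration (T : eqType) (A : T -> Prop) Q :
  (forall r, uniq r -> (forall x, x \in r -> A x) -> size r <= Q) ->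
  exists2 r, uniq r & forall x, A x <-> x \in r.
Proof.
move=> AQ; pose P n := `[< exists r, [/\ uniq r, forall x, x \in r -> A x & size r = n] >].
have P0 : exists n, P n by exists 0; apply/asboolP; exists [::].
have PQ n : P n -> n <= Q by move=> /asboolP [r [ur rA <-]]; apply: AQ.
case: (ex_maxnP P0 PQ) => n /asboolP [r [ur rA rn]] nmax.
exists r => // x; split=> [Ax|]; last exact: rA.
apply: contraT => xr; suff : n.+1 <= n by rewrite ltnn.
apply: nmax; apply/asboolP; exists (x :: r); rewrite /= xr ur rn; split=> // y.
by rewrite inE => /orP[/eqP ->|/rA].
Qed.

(** * The action of automorphisms on words *)

Section Action.
Variable X : nat -> finType.
Implicit Types (g h : aut X 0) (s t v : seq (letter X)) (x : nat -> letter X).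

(** Automorphisms act on vertices, which carry a proof of being words; extending
    them by the identity to all sequences of letters makes [take] and [drop]
    directly applicable to the images. *)
Definition act g s : seq (letter X) :=
  if (insub s : option {s | is_word 0 s}) is Some v then val (g v) else s.

Lemma act_val g (v : vertex X 0) : act g (val v) = val (g v).
Proof. by rewrite /act valK. Qed.

Lemma act_nonword g s : ~~ is_word 0 s -> act g s = s.
Proof. by move=> ns; rewrite /act insubN. Qed.

Lemma vertex_of s : is_word 0 s -> exists v : vertex X 0, s = val v.
Proof. by move=> ws; exists (exist _ s ws). Qed.

Lemma size_act g s : size (act g s) = size s.
Proof.
case: (boolP (is_word 0 s)) => [/vertex_of [v ->]|/act_nonword -> //].
by rewrite act_val; apply: len_aut.
Qed.

Lemma act_is_word g s : is_word 0 (act g s) = is_word 0 s.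
Proof.
case: (boolP (is_word 0 s)) => [/vertex_of [v ->]|ns].
  by rewrite act_val; apply: valP.
by rewrite act_nonword // (negbTE ns).
Qed.

Lemma act1 s : act 1%g s = s.
Proof.
by case: (boolP (is_word 0 s)) => [/vertex_of [v ->]|/act_nonword -> //]; rewrite act_val.
Qed.

Lemma actM g h s : act (g * h)%g s = act g (act h s).
Proof.
case: (boolP (is_word 0 s)) => [/vertex_of [v ->]|ns]; first by rewrite !act_val.
by rewrite !act_nonword.
Qed.

Lemma actK g : cancel (act g) (act g^-1%g).
Proof. by move=> s; rewrite -actM mulVg act1. Qed.

Lemma actVK g : cancel (act g^-1%g) (act g).
Proof. by move=> s; rewrite -actM mulgV act1. Qed.

Lemma actX g n s : act (g ^+ n)%g s = iter n (act g) s.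
Proof. by elim: n => [|n IHn] /=; rewrite ?act1 // expgS actM IHn. Qed.

Lemma act_faithful g : (forall s, is_word 0 s -> act g s = s) -> g = 1%g.
Proof.
by move=> gE; apply: aut_eq => v; apply: val_inj; rewrite -act_val gE //; apply: valP.
Qed.

Lemma is_word_take s n : is_word 0 s -> is_word 0 (take n s).
Proof. by rewrite -{1}(cat_take_drop n s) is_word_cat => /andP[]. Qed.

(** This is the defining equation of the section at the vertex [take n s]. *)
Lemma act_take g s n : is_word 0 s -> take n (act g s) = act g (take n s).
Proof.
move=> ws; have := ws; rewrite -{1}(cat_take_drop n s) is_word_cat => /andP[wt wd].
case: (leqP (size s) n) => sn; first by rewrite !take_oversize // size_act.
have [v vE] := vertex_of wt; have [w wE] := vertex_of ws.
have vn : len v = n by rewrite /len -vE size_takel // ltnW.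
have [|u uE] := @wcatP _ _ _ _ (erefl (len v)) w.
  by rewrite -vE -wE prefix_take.
rewrite vE wE !act_val uE sectionE /= take_cat.
rewrite (_ : size (val (g v)) = n); last by rewrite -vn -(len_aut g).
by rewrite ltnn subnn take0 cats0.
Qed.

Lemma drop_trivial_at_level k (h : aut X k) n (u : vertex X k) :
  trivial_at_level h n -> drop n (val (h u)) = drop n (val u).
Proof.
move=> hn; case: (leqP (len u) n) => un.
  by rewrite !drop_oversize // [size _](len_aut h u).
have : is_word k (take n (val u) ++ drop n (val u)) by rewrite cat_take_drop; apply: valP.
rewrite is_word_cat => /andP[wt _].
pose p : vertex X k := exist _ (take n (val u)) wt.
have pn : len p = n by rewrite /len /= size_takel // ltnW.
have [|q qE] := @wcatP _ _ _ _ (erefl (len p)) u; first exact: prefix_take.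
have hpn : size (val (h p)) = n by rewrite -pn; apply: len_aut.
by rewrite qE sectionE hn //= !drop_size_cat.
Qed.

(** Boundedness without sections: when a section is finitary of depth at most m,
    the image of a longer word has the same letters from position m on. *)
Definition perturbs_only_along (W : seq (nat -> letter X)) m g :=
  forall s k, is_word 0 s -> k <= size s ->
    (forall x, x \in W -> take k s <> mkseq x k) ->
    drop (k + m) (act g s) = drop (k + m) s.

Lemma bounded_perturbs g : bounded g -> exists W m, perturbs_only_along W m g.
Proof.
move=> [W [m [/finite_seqP [r ->] gW]]].
exists [seq (fun i => Tagged X (w i)) | w <- r], m => s k ws ks nW.
have := is_word_take k ws => /vertex_of [v vE].
have vk : len v = k by rewrite /len -vE size_takel.
have [w wE] := vertex_of ws.
have [|u uE] := @wcatP _ _ _ _ (erefl (len v)) w; first by rewrite -vE -wE prefix_take.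
have [|d [dtriv _] dm] := gW v.
  move=> y /= yr; rewrite /beginning vk => vy; apply: (nW (fun i => Tagged X (y i))).
    by apply/mapP; exists y.
  by rewrite vE.
rewrite wE act_val uE sectionE -vk.
have dropE (a b : seq (letter X)) : size a = len v -> drop (len v + m) (a ++ b) = drop (m - d) (drop d b).
  by move=> av; rewrite drop_cat av ltnNge leq_addr /= addKn drop_drop subnK.
have gv : size (val (g v)) = len v := len_aut g v.
rewrite [LHS](dropE _ (val (section g v u)) gv) [RHS](dropE (val v) (val u)) //.
by rewrite drop_trivial_at_level.
Qed.

Lemma perturbs_weaken W W' m m' g : {subset W <= W'} -> m <= m' ->
  perturbs_only_along W m g -> perturbs_only_along W' m' g.
Proof.
move=> WW' mm' gW s k ws ks nW.
have := gW s k ws ks (fun x xW => nW x (WW' x xW)) => /(congr1 (drop (m' - m))).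
by rewrite !drop_drop addnCA subnK // [k + _]addnC.
Qed.

Fixpoint words k n : seq (seq (letter X)) :=
  if n is n'.+1 then [seq Tagged X a :: t | a <- enum (X k), t <- words k.+1 n'] else [:: [::]].

Lemma mem_words k n s : is_word k s -> size s = n -> s \in words k n.
Proof.
elim: n k s => [|n IHn] k [|a s] //= ; rewrite /is_word /= => /eqP [ak sk] [sn].
have [y yE] := letterP ak; rewrite yE.
apply/allpairsP; exists (y, s); split=> //=; first by rewrite mem_enum.
by apply: IHn => //; rewrite /is_word sk.
Qed.

Lemma size_words N k n : (forall i, #|X i| <= N) -> size (words k n) <= N ^ n.
Proof.
move=> XN; elim: n k => //= n IHn k; rewrite size_allpairs -cardE expnS.
exact: leq_mul.
Qed.

End Action.

(** * Rays *)

Section Rays.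
Variable X : nat -> finType.
Implicit Types (s : seq (letter X)) (x y : nat -> letter X).

(** Q s says that s has extensions in P of all lengths.  It is inherited by one
    of the finitely many one-letter extensions of s, because P is closed under
    prefixes. *)
Lemma koenig (P : seq (letter X) -> Prop) :
  (forall s n, P s -> P (take n s)) -> (forall s, P s -> is_word 0 s) ->
  (forall n, exists2 s, P s & size s = n) -> exists x, forall n, P (mkseq x n).
Proof.
move=> Ptake Pword Pall.
pose Q s := forall n, size s <= n -> exists u, [/\ P u, size u = n & take (size s) u = s].
have Q0 : Q [::].
  by move=> n _; have [u Pu un] := Pall n; exists u; rewrite take0.
have QS s : Q s -> exists l, Q (rcons s l).
  move=> Qs; apply: contrapT => /forallNP nQ.
  have [L LP] : exists L : letter X -> nat, forall l, size s < L l /\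
      forall u, P u -> size u = L l -> take (size s).+1 u <> rcons s l.
    have /choice[L LP] : forall l, exists n, size s < n /\
        forall u, P u -> size u = n -> take (size s).+1 u <> rcons s l.
      move=> l; apply: contrapT => /forallNP nn; apply: (nQ l) => n; rewrite size_rcons => sn.
      apply: contrapT => /forallNP nu; apply: (nn n); split=> // u Pu un ul.
      by apply: (nu u).
    by exists L.
  pose n := maxn (size s).+1 (\max_(c : X (size s)) L (Tagged X c)).
  have [|u [Pu un us]] := Qs n; first by rewrite /n; lia.
  have su : size s < size u by rewrite un /n; lia.
  have wu := Pword _ Pu.
  case: u => [//|d u] in Pu un us su wu *; set u' := d :: u in Pu un us su wu *.
  pose l := nth d u' (size s).
  have tu : take (size s).+1 u' = rcons s l by rewrite (take_nth d) // us.
  have tl : tag l = size s.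
    move: wu; rewrite /is_word => /eqP /(congr1 (fun r => nth 0 r (size s))).
    by rewrite (nth_map d) // nth_iota.
  have [c cE] := letterP tl; have [sL] := LP l; case/(_ (take (L l) u')).
  - exact: Ptake.
  - by rewrite size_takel // un /n cE leq_max (leq_bigmax c) orbT.
  - by rewrite take_takel.
have [a0 _] := QS _ Q0.
have /choice[next nextP] : forall s, exists l, Q s -> Q (rcons s l).
  move=> s; case: (pselect (Q s)) => [/QS[l Ql]|nQ]; first by exists l.
  by exists a0 => /nQ.
pose w n := iter n (fun s => rcons s (next s)) [::].
have Qw n : Q (w n) by elim: n => //= n /nextP.
have wE n : mkseq (fun i => next (w i)) n = w n.
  by elim: n => // n IHn; rewrite /mkseq -addn1 iotaD map_cat -/(mkseq _ _) IHn cats1 addn1.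
exists (fun i => next (w i)) => n; rewrite wE.
by have [u [Pu un <-]] := Qw n _ (leqnn _); rewrite -un take_size.
Qed.

Lemma take_mkseq x k n : k <= n -> take k (mkseq x n) = mkseq x k.
Proof. by move=> kn; rewrite /mkseq -map_take take_iota (minn_idPl kn). Qed.

Lemma separating_level x (W : seq (nat -> letter X)) : exists n, forall y, y \in W ->
  mkseq y n = mkseq x n -> y = x.
Proof.
elim: W => [|z W [n IHn]]; first by exists 0.
have [k kP] : exists k, mkseq z k = mkseq x k -> z = x.
  apply: contrapT => /forallNP nk; apply: (nk 0) => _; apply/funext => i.
  have : mkseq z i.+1 = mkseq x i.+1 by apply: contrapT => H; apply: (nk i.+1) => /H.
  by move=> /(congr1 (fun r => nth (x i) r i)); rewrite !nth_mkseq.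
exists (maxn n k) => y; rewrite inE => /orP[/eqP ->|yW] E.
  by apply: kP; rewrite -!(take_mkseq _ (leq_maxr n k)) E.
by apply: IHn => //; rewrite -!(take_mkseq _ (leq_maxl n k)) E.
Qed.

End Rays.

(** * Rigid vertices and germs *)

Section Cones.
Variables (X : nat -> finType) (N : nat).
Hypotheses (XN : forall i, #|X i| <= N) (N_gt0 : 0 < N).
Implicit Types (g h : aut X 0) (s t v : seq (letter X)) (x y : nat -> letter X).

Lemma is_word_iter g i s : is_word 0 (iter i (act g) s) = is_word 0 s.
Proof. by elim: i => //= i IHi; rewrite act_is_word. Qed.

Lemma size_iter g i s : size (iter i (act g) s) = size s.
Proof. by elim: i => //= i IHi; rewrite size_act. Qed.

Definition fixes_level n g := forall s, is_word 0 s -> size s <= n -> act g s = s.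
Definition fixes_cone v g := forall s, is_word 0 s -> prefix v s -> act g s = s.

Lemma fact_fixes_level n g : fixes_level n (g ^+ (N ^ n)`!)%g.
Proof.
move=> s ws sn; rewrite actX; apply: (iter_fact_periodic (r := words X 0 (size s))).
- exact: can_inj (actK g).
- by move=> i; apply: mem_words; rewrite ?size_iter ?is_word_iter.
- by apply: leq_trans (size_words _ _ XN) _; apply: leq_pexp2l.
Qed.

Lemma fixes_levelM n g h : fixes_level n g -> fixes_level n h -> fixes_level n (g * h)%g.
Proof. by move=> gn hn s ws sn; rewrite actM hn // gn. Qed.

Lemma fixes_levelV n g : fixes_level n g -> fixes_level n g^-1%g.
Proof. by move=> gn s ws sn; rewrite -{1}(gn s) // actK. Qed.

Lemma fixes_levelX n g k : fixes_level n g -> fixes_level n (g ^+ k)%g.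
Proof.
move=> gn; elim: k => [|k IHk]; first by move=> s; rewrite act1.
by rewrite expgS; apply: fixes_levelM.
Qed.

Lemma prefix_act n g v s : fixes_level n g -> size v = n -> is_word 0 s ->
  prefix v (act g s) = prefix v s.
Proof.
move=> gn vn ws; rewrite !prefixE vn act_take // gn ?is_word_take //.
by rewrite size_take; case: ltnP.
Qed.

Lemma fixes_coneV v g : fixes_cone v g -> fixes_cone v g^-1%g.
Proof. by move=> gv s ws sv; rewrite -{1}(gv s) // actK. Qed.

Lemma fixes_coneX v g k : fixes_cone v g -> fixes_cone v (g ^+ k)%g.
Proof.
move=> gv; elim: k => [|k IHk] s ws vs; rewrite ?act1 //.
by rewrite expgS actM IHk // gv.
Qed.

Lemma fixes_cone_conj n v f g : fixes_level n f -> size v = n ->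
  fixes_cone v g -> fixes_cone v (f * g / f)%g.
Proof.
move=> fn vn gv s ws vs; rewrite !actM gv ?actVK ?act_is_word //.
by rewrite (prefix_act (n := n)) //; apply: fixes_levelV.
Qed.

(** A commutator of elements fixing level n is trivial below v as soon as one of
    its entries is, since the other entry permutes the words that begin with
    v. *)
Lemma fixes_cone_commL n v g h : fixes_level n h -> size v = n ->
  fixes_cone v g -> fixes_cone v (g * h / g / h)%g.
Proof.
move=> hn vn gv s ws vs; have hn' := fixes_levelV hn.
rewrite !actM (fixes_coneV gv) ?act_is_word //; last by rewrite (prefix_act hn').
by rewrite actVK gv.
Qed.

Lemma fixes_cone_commR n v g h : fixes_level n g -> size v = n ->
  fixes_cone v h -> fixes_cone v (g * h / g / h)%g.
Proof.
move=> gn vn hv s ws vs; have gn' := fixes_levelV gn.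
rewrite !actM (fixes_coneV hv) // hv ?act_is_word ?actVK //.
by rewrite (prefix_act gn').
Qed.

Section RigidVertices.
Variables (a b : aut X 0).
Hypotheses (free_ab : free2 a b) (ab : a != b).

Definition rigid v := forall g, gen2 a b g -> fixes_cone v g -> g = 1%g.

(** If no vertex of level n is rigid, then for every set V of vertices of level n
    there is a nontrivial h in <a, b> which is trivial on level n and below all
    vertices of V: a new vertex is added to V by taking a commutator of
    conjugates.  When V is the whole level, h is trivial. *)
Lemma exists_rigid n : exists v, [/\ is_word 0 v, size v = n & rigid v].
Proof.
apply: contrapT => /forallNP norig.
pose M := (N ^ n)`!; have M0 : 0 < M by apply: fact_gt0.
have aM k : fixes_level n (a ^+ (M * k))%g.
  by rewrite expgnA; apply: fixes_levelX; apply: fact_fixes_level.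
have bM k : fixes_level n (b ^+ (M * k))%g.
  by rewrite expgnA; apply: fixes_levelX; apply: fact_fixes_level.
(* Replacing an element by its M-th power makes it trivial on level n. *)
have tf g : gen2 a b g -> g != 1%g -> (g ^+ M)%g != 1%g.
  move=> Fg; apply: contraNneq => gM; apply/eqP.
  by apply: (free2_torsion_free free_ab (k := M.-1) Fg); rewrite prednK.
have Fa := gen2l a b; have Fb := gen2r a b.
have step (V : seq (seq (letter X))) : (forall v, v \in V -> is_word 0 v /\ size v = n) ->
    exists h, [/\ gen2 a b h, h != 1%g, fixes_level n h &
                  forall v, v \in V -> fixes_cone v h].
  elim: V => [|v V IHV] hV.
    exists (a ^+ M)%g; split=> //; last exact: fact_fixes_level; first exact: gen2X.
    apply: tf => //; apply/eqP => a1.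
    have := @free_ab [:: (a, false)]; rewrite /word_on /= inE eqxx.
    by rewrite eval_cons eval_nil mulg1 => /(_ isT isT a1).
  have [|h [Fh h1 hn hV']] := IHV; first by move=> u uV; apply: hV; rewrite inE uV orbT.
  have [wv vn] := hV v (mem_head _ _).
  have [g0 [Fg0 g0v g01]] : exists g, [/\ gen2 a b g, fixes_cone v g & g != 1%g].
    apply: contrapT => /forallNP ng; apply: (norig v); split=> // g Fg gv.
    by apply: contrapT => /eqP g1; apply: (ng g).
  have Fg : gen2 a b (g0 ^+ M)%g by apply: gen2X.
  have gn : fixes_level n (g0 ^+ M)%g by apply: fact_fixes_level.
  have gv : fixes_cone v (g0 ^+ M)%g by apply: fixes_coneX.
  move: (g0 ^+ M)%g (tf _ Fg0 g01) Fg gn gv => g g1 Fg gn gv.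
  have [f [f' [[i [j fE]] [i' [j' fE']] c1]]] := free2_noncommuting_conj free_ab ab Fg Fh g1 h1 M0.
  have Ff : gen2 a b f by rewrite fE; apply: gen2M; apply: gen2X.
  have Ff' : gen2 a b f' by rewrite fE'; apply: gen2M; apply: gen2X.
  have fn : fixes_level n f by rewrite fE; apply: fixes_levelM.
  have fn' : fixes_level n f' by rewrite fE'; apply: fixes_levelM.
  have cn k : fixes_level n k -> forall e, fixes_level n e -> fixes_level n (k * e / k)%g.
    by move=> kn e en; do !apply: fixes_levelM => //; apply: fixes_levelV.
  exists (((f * g / f) * (f' * h / f') / (f * g / f) / (f' * h / f')))%g; split=> //.
  - by do ![apply: gen2M => // | apply: gen2V => //].
  - by do ![apply: fixes_levelM => // | apply: fixes_levelV => //].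
  move=> u; rewrite inE => /orP[/eqP ->|uV].
    apply: (fixes_cone_commL (n := n)) => //; first exact: cn.
    exact: (fixes_cone_conj (n := n)).
  have [_ un] := hV u (mem_behead (s := v :: V) uV).
  apply: (fixes_cone_commR (n := n)) => //; first exact: cn.
  by apply: (fixes_cone_conj (n := n)) => //; apply: hV'.
have [|h [_ /eqP h1 hn hc]] := step [seq v <- words X 0 n | is_word 0 v & size v == n].
  by move=> v; rewrite mem_filter => /andP[/andP[-> /eqP ->]].
apply: h1; apply: act_faithful => s ws; case: (leqP (size s) n) => sn; first exact: hn.
apply: (hc (take n s)) (prefix_take _ _) => //.
have sz : size (take n s) = n by rewrite size_takel // ltnW.
by rewrite mem_filter mem_words ?is_word_take // sz eqxx.
Qed.

End RigidVertices.

(** Let n be a level at which x has left all other singular rays of g, and let s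
    be a word which follows x up to level n and leaves it at level j.  Then g s
    leaves x at the same level j, because g fixes x; and it agrees with s from
    level j + 1 + m on.  So the orbit of s under g has at most N ^ (m + 1)
    elements, which bounds the order of g on s independently of s. *)
Lemma bounded_fixing_ray g x : bounded g ->
  (forall n, act g (mkseq x n) = mkseq x n) ->
  exists n k, fixes_cone (mkseq x n) (g ^+ k.+1)%g.
Proof.
move=> /bounded_perturbs [W [m gW]] gx.
have [n nP] := separating_level x W.
exists n, (N ^ m.+1)`!.-1; rewrite prednK ?fact_gt0 // => s ws.
rewrite prefixE size_mkseq => /eqP sn; rewrite actX.
have [sx|sx] := eqVneq s (mkseq x (size s)).
  by rewrite iter_fix // sx gx.
have ex_k : exists k, take k s != mkseq x k by exists (size s); rewrite take_size.
case: (ex_minnP ex_k) => -[|j] jP jmin; first by rewrite take0 in jP.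
have js : j < size s by apply: jmin; rewrite take_size.
have sj : take j s = mkseq x j.
  by apply/eqP; apply: contraTT isT => /jmin; rewrite ltnn.
have nj : n <= j.
  rewrite leqNgt; apply/negP => jn; move/negP: jP; apply; apply/eqP.
  by rewrite -(take_mkseq x jn) -sn take_takel.
(* j is the length of the longest common prefix of s and x. *)
pose st i := iter i (act g) s.
have wst i : is_word 0 (st i) by rewrite is_word_iter.
have zst i : size (st i) = size s by rewrite size_iter.
have st_inv i : [/\ take j (st i) = mkseq x j, take j.+1 (st i) != mkseq x j.+1 &
    drop (j.+1 + m) (st i) = drop (j.+1 + m) s].
  elim: i => [//|i [IH1 IH2 IH3]]; rewrite /st /= -/(st i) !act_take //; split.
  - by rewrite IH1 gx.
  - by rewrite -(gx j.+1) (inj_eq (can_inj (actK g))).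
  rewrite (gW (st i) j.+1) ?zst // => y yW E.
  case/eqP: IH2; rewrite E (nP y yW) //.
  by rewrite -(take_mkseq y (leqW nj)) -E (take_takel _ (leqW nj)) -(take_takel _ nj) IH1 take_mkseq.
pose p := minn m.+1 (size s - j).
apply: (iter_fact_periodic (r := [seq mkseq x j ++ t ++ drop (j.+1 + m) s | t <- words X j p])).
- exact: can_inj (actK g).
- move=> i; rewrite -/(st i); have [t1 _ t3] := st_inv i.
  apply/mapP; exists (take m.+1 (drop j (st i))).
    apply: mem_words; last by rewrite size_take_min size_drop zst.
    have := wst i; rewrite -{1}(cat_take_drop j (st i)) is_word_cat t1 size_mkseq add0n.
    by rewrite -{1}(cat_take_drop m.+1 (drop j (st i))) is_word_cat => /andP[_ /andP[]].
  by rewrite -t3 -t1 addSnnS addnC -drop_drop !cat_take_drop.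
- rewrite size_map; apply: leq_trans (size_words _ _ XN) _.
  by apply: leq_pexp2l => //; apply: geq_minl.
Qed.

End Cones.

(** * Counting in a free orbit *)

Section Orbit.
Variables (X : nat -> finType) (N : nat).
Hypotheses (XN : forall i, #|X i| <= N) (N_gt0 : 0 < N).
Implicit Types (g h : aut X 0) (s t : seq (letter X)) (y : nat -> letter X).
Implicit Types (w : seq (aut X 0 * bool)).
Variables (a b : aut X 0).
Hypotheses (free_ab : free2 a b) (ab : a != b).
Variables (x : nat -> letter X) (W : seq (nat -> letter X)) (m : nat).
Hypothesis word_x : forall n, is_word 0 (mkseq x n).
Hypothesis x_free :
  forall g, gen2 a b g -> (forall n, act g (mkseq x n) = mkseq x n) -> g = 1%g.
Hypothesis W_letters :
  forall l, l.1 \in [:: a; b] -> perturbs_only_along W m (eval_letter l).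

Definition fword w := word_on a b w && reduced w.
(** The sequence of the vertices [orb w n] is the image of the ray x under w. *)
Definition orb w n := act (eval_word w) (mkseq x n).
Definition tail_eq n w w' := forall k, drop n (orb w k) = drop n (orb w' k).

Lemma size_orb w n : size (orb w n) = n.
Proof. by rewrite size_act size_mkseq. Qed.

Lemma word_orb w n : is_word 0 (orb w n).
Proof. by rewrite act_is_word. Qed.

Lemma take_orb w k n : k <= n -> take k (orb w n) = orb w k.
Proof. by move=> kn; rewrite act_take // take_mkseq. Qed.

Lemma orb_inj w w' : fword w -> fword w' -> orb w =1 orb w' -> w = w'.
Proof.
move=> /andP[hw rw] /andP[hw' rw'] E; apply: (eval_word_inj free_ab) => //.
rewrite -[LHS]invgK; apply: mulg1_eq; apply: x_free.
  by apply: gen2M; [apply: gen2V; exists w | exists w'].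
by move=> n; rewrite actM -[act _ (mkseq x n)](E n) actK.
Qed.

Lemma tail_eq_orb n w w' : tail_eq n w w' -> orb w n = orb w' n -> orb w =1 orb w'.
Proof.
move=> tw wn k; case: (leqP n k) => nk.
  by rewrite -(cat_take_drop n (orb w k)) tw take_orb // wn -(take_orb w' nk) cat_take_drop.
by rewrite -!(take_orb _ (ltnW nk)) wn.
Qed.

Lemma tail_eq_mono n n' w w' : n <= n' -> tail_eq n w w' -> tail_eq n' w w'.
Proof. by move=> nn' tw k; rewrite -(subnK nn') -!drop_drop tw. Qed.

(** The edge of the orbit from w x to l w x can change the tail after level k + m
    only at a point w x which follows a singular ray up to level k. *)
Lemma tail_eq_cons k l w : l.1 \in [:: a; b] -> (forall y, y \in W -> orb w k <> mkseq y k) ->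
  tail_eq (k + m) (l :: w) w.
Proof.
move=> hl nW n; case: (leqP k n) => kn; last first.
  by rewrite !drop_oversize // size_orb; apply: ltnW; apply: ltn_addr.
rewrite {1}/orb eval_cons actM; apply: (W_letters hl); rewrite ?word_orb ?size_orb //.
by move=> y yW; rewrite take_orb //; apply: nW.
Qed.

Lemma fword_cons l w : fword w -> l \in letters a b -> reduced (l :: w) -> fword (l :: w).
Proof. by rewrite mem_letters /fword /word_on /= => /andP[-> _] -> ->. Qed.

(** Let C be the class of w0.  The words l w with w in C are at least 2 |C| in
    number, and at most |C| of them are in C.  If l w is not in C, then w x
    begins like a singular ray up to level k; as the tail of w x after level
    k + m is prescribed, the point w x is determined by this beginning and by
    the m letters that follow, which leaves 4 |W| N^m possibilities for the pair
    (l, w).  Hence |C| is at most 4 |W| N^m. *)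
Lemma tail_class_bound k w0 B : uniq B ->
  (forall w, w \in B -> fword w /\ tail_eq (k + m) w0 w) -> size B <= 4 * (size W * N ^ m).
Proof.
pose A w := fword w /\ tail_eq (k + m) w0 w; move=> uB BA.
have AA w w' : A w -> A w' -> tail_eq (k + m) w w'.
  by move=> [_ Aw] [_ Aw'] i; rewrite -Aw -Aw'.
have A_inj w w' : A w -> A w' -> orb w (k + m) = orb w' (k + m) -> w = w'.
  move=> Aw Aw' E; apply: orb_inj; [by case: Aw | by case: Aw'|].
  exact: tail_eq_orb (AA _ _ Aw Aw') E.
have [C uC AC] : exists2 C, uniq C & forall w, A w <-> w \in C.
  apply: (@finite_enumeration _ _ (N ^ (k + m))) => r ur rA.
  rewrite -(size_map (fun w => orb w (k + m))).
  apply: leq_trans (size_words 0 (k + m) XN); apply: uniq_leq_size.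
    rewrite map_inj_in_uniq // => w w' wr w'r; apply: A_inj; exact: rA.
  by move=> _ /mapP[w _ ->]; apply: mem_words; rewrite ?word_orb ?size_orb.
apply: (@leq_trans (size C)).
  by apply: uniq_leq_size => // w /BA /AC.
pose kids w := [seq l <- letters a b | reduced (l :: w)].
pose D := [seq l :: w | w <- C, l <- kids w].
have uD : uniq D.
  apply: allpairs_uniq_dep => //; first by move=> w _; rewrite filter_uniq // uniq_letters.
  by move=> [w l] [w' l'] _ _ /= [-> ->].
have DP v : v \in D -> exists l w, [/\ v = l :: w, l \in letters a b, A w & fword v].
  move=> /allpairsPdep[w [l [wC lw ->]]]; exists l, w.
  move: lw; rewrite mem_filter => /andP[rw lab]; have Aw := (AC w).2 wC.
  by split=> //; apply: fword_cons => //; case: Aw.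
have szD : 2 * size C <= size D.
  have : forall w, w \in C -> fword w by move=> w /AC [].
  rewrite /D size_allpairs_dep; elim: (C) => [|w r IHr] //= hr.
  rewrite mulnS leq_add //.
    by rewrite size_filter; have /andP[hw rw] := hr w (mem_head _ _); apply: two_children.
  by apply: IHr => u ur; apply: hr; rewrite inE ur orbT.
have inD : count (mem C) D <= size C.
  rewrite -size_filter; apply: uniq_leq_size; first exact: filter_uniq.
  by move=> v; rewrite mem_filter => /andP[].
suff outD : count (predC (mem C)) D <= 4 * (size W * N ^ m).
  rewrite -(leq_add2l (size C)) addnn -mul2n; apply: leq_trans szD _.
  by rewrite -(count_predC (mem C) D) leq_add.
(* The beginning of w x up to level k + m is recorded together with l. *)
pose code (v : seq (aut X 0 * bool)) := (head (a, false) v, orb (behead v) (k + m)).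
pose target := [seq (l, p) | l <- letters a b,
  p <- [seq mkseq y k ++ t | y <- W, t <- words X k m]].
apply: (@leq_trans (size target)); last first.
  by rewrite !size_allpairs leq_mul // leq_mul // size_words.
rewrite -size_filter -(size_map code); apply: uniq_leq_size.
  rewrite map_inj_in_uniq ?filter_uniq // => v v'.
  rewrite !mem_filter => /andP[_ /DP[l [w [-> _ Aw _]]]] /andP[_ /DP[l' [w' [-> _ Aw' _]]]].
  by move=> [<- /A_inj <-].
move=> _ /mapP[v + ->]; rewrite mem_filter => /andP[/= vC /DP[l [w [vE lab Aw fv]]]].
rewrite vE /code /=; apply: allpairs_f => //.
have [y yW yE] : exists2 y, y \in W & orb w k = mkseq y k.
  apply: contrapT => nW; move/negP: vC; apply; apply/AC; split=> // i.
  rewrite vE tail_eq_cons; first by case: Aw => _ ->.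
    by rewrite -mem_letters.
  by move=> y yW yE; apply: nW; exists y.
rewrite -(cat_take_drop k (orb w (k + m))) take_orb ?leq_addr // yE.
apply: allpairs_f => //; apply: mem_words; last by rewrite size_drop size_orb addKn.
have := word_orb w (k + m); rewrite -{1}(cat_take_drop k (orb w (k + m))) is_word_cat.
by rewrite take_orb ?leq_addr // size_orb => /andP[].
Qed.

(** A free orbit meets the singular rays in finitely many points, so the edges
    from a^i x to a^(i+1) x preserve tails for all large i.  Any number of these
    points then have a common tail, against [tail_class_bound]. *)
Lemma infinite_orbit_contradiction : False.
Proof.
pose pw i : seq (aut X 0 * bool) := nseq i (a, false).
have fpw i : fword (pw i).
  by rewrite /fword /word_on all_nseq /= inE eqxx orbT reduced_nseq.
have pw_inj i j : pw i = pw j -> i = j by move=> /(congr1 size); rewrite !size_nseq.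
(* As the orbit is free, each singular ray is a^i x for at most one i. *)
have [T avoid] : exists T, forall i, T <= i -> forall y, y \in W -> ~ (orb (pw i) =1 mkseq y).
  elim: (W) => [|y V [T IHT]]; first by exists 0.
  have [[i0 i0y]|ny] := pselect (exists i, orb (pw i) =1 mkseq y); last first.
    exists T => i Ti z; rewrite inE => /orP[/eqP -> iy|]; last exact: IHT.
    by apply: ny; exists i.
  exists (maxn T i0.+1) => i; rewrite geq_max => /andP[Ti ii0] z.
  rewrite inE => /orP[/eqP -> iy|]; last exact: IHT.
  have /pw_inj E : pw i = pw i0 by apply: orb_inj => // n; rewrite iy i0y.
  by rewrite E ltnn in ii0.
have step i : T <= i -> exists k, forall y, y \in W -> orb (pw i) k <> mkseq y k.
  move=> /avoid; elim: (W) => [|y V IHV] hV; first by exists 0.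
  have [|k kV] := IHV; first by move=> z zV; apply: hV; rewrite inE zV orbT.
  have [k' k'y] : exists k', orb (pw i) k' <> mkseq y k'.
    by apply/existsNP => H; apply: (hV y (mem_head _ _)).
  exists (maxn k k') => z; rewrite inE => /orP[/eqP ->|zV] E.
    by apply: k'y; rewrite -(take_orb _ (leq_maxr k k')) E take_mkseq // leq_maxr.
  by apply: (kV z zV); rewrite -(take_orb _ (leq_maxl k k')) E take_mkseq // leq_maxl.
pose K := 4 * (size W * N ^ m).
have [k kE] : exists k, forall i, i <= K -> tail_eq (k + m) (pw T) (pw (T + i)).
  elim: K => [|K [k IHk]].
    by exists 0 => i; rewrite leqn0 => /eqP ->; rewrite addn0.
  have [k' k'W] := step (T + K) (leq_addr _ _).
  exists (maxn k k') => i; rewrite leq_eqVlt => /orP[/eqP ->|]; last first.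
    by rewrite ltnS => /IHk; apply: tail_eq_mono; rewrite leq_add2r leq_maxl.
  have /tail_eq_mono tk := IHk K (leqnn K); move=> n; rewrite (tk (maxn k k' + m)) ?leq_add2r ?leq_maxl //.
  have := @tail_eq_cons k' (a, false) (pw (T + K)); rewrite /= inE eqxx => /(_ isT k'W) /tail_eq_mono.
  by move=> tk'; rewrite addnS; apply/esym/tk'; rewrite leq_add2r leq_maxr.
have : size [seq pw (T + i) | i <- iota 0 K.+1] <= K.
  apply: (@tail_class_bound k (pw T)).
    by rewrite map_inj_uniq ?iota_uniq // => i j /pw_inj /addnI.
  by move=> _ /mapP[i + ->]; rewrite mem_iota ltnS => /kE; split.
by rewrite size_map size_iota ltnn.
Qed.

End Orbit.

(** * Conclusion *)

Lemma uniform_letters (X : nat -> finType) (r : seq (aut X 0)) :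
  (forall g, g \in r -> bounded g) ->
  exists W m, forall g, g \in r -> perturbs_only_along W m g.
Proof.
elim: r => [|g r IHr] hr; first by exists [::], 0.
have [|W [m Wm]] := IHr; first by move=> h hh; apply: hr; rewrite inE hh orbT.
have [W' [m' W'm']] := bounded_perturbs (hr g (mem_head _ _)).
exists (W ++ W'), (maxn m m') => h; rewrite inE => /orP[/eqP ->|hh].
  by apply: perturbs_weaken W'm'; rewrite ?leq_maxr // => y yW; rewrite mem_cat yW orbT.
by apply: perturbs_weaken (Wm h hh); rewrite ?leq_maxl // => y yW; rewrite mem_cat yW.
Qed.

Lemma no_free2_bounded (X : nat -> finType) N (a b : aut X 0) :
  (forall i, #|X i| <= N) -> free2 a b -> a != b ->
  (forall g, gen2 a b g -> bounded g) -> False.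
Proof.
move=> XN' free_ab ab Fbounded.
have XN i : #|X i| <= N.+1 by apply: leqW.
pose P s := is_word 0 s /\ rigid a b s.
have [|||x xP] := @koenig X P.
- move=> s n [ws rs]; split; first exact: is_word_take.
  move=> g Fg gc; apply: rs => // t wt st; apply: gc => //.
  exact: prefix_trans (prefix_take _ _) st.
- by move=> s [].
- by move=> n; have [v [wv vn rv]] := exists_rigid XN (ltn0Sn N) free_ab ab n; exists v.
have x_free g : gen2 a b g -> (forall n, act g (mkseq x n) = mkseq x n) -> g = 1%g.
  move=> Fg gx; have [n [k nk]] := bounded_fixing_ray XN (ltn0Sn N) (Fbounded g Fg) gx.
  apply: (free2_torsion_free free_ab (k := k) Fg).
  by apply: (xP n).2 => //; apply: gen2X.
have [|W [m Wm]] := @uniform_letters X [:: a; a^-1; b; b^-1]%g.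
  move=> g; rewrite !inE => gE; apply: Fbounded.
  have Fa := gen2l a b; have Fb := gen2r a b.
  by case/or4P: gE => /eqP -> //; apply: gen2V.
apply: (@infinite_orbit_contradiction X N.+1 XN a b free_ab ab x W m) => //.
- by move=> n; case: (xP n).
- by move=> [g e]; rewrite !inE /= => /orP[] /eqP ->; case: e; apply: Wm;
    rewrite /eval_letter /= !inE eqxx ?orbT.
Qed.

Theorem theorem4p4 (X : nat -> finType)
    (X_nonempty : forall i, 0 < #|X i|)
    (X_bounded : exists N, forall i, #|X i| <= N) :
  ~ exists H : set (aut X 0),
      [/\ subgroup H, H `<=` bounded_automorphisms X, free_group H & ~ abelian_group H].
Proof.
move=> [H [_ Hbounded freeH nabH]]; have [N XN] := X_bounded.
have [a [b [ab free_ab FH]]] := free_nonabelian_free2 freeH nabH.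
by apply: (no_free2_bounded XN free_ab ab) => g /FH /Hbounded.
Qed.
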